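(* Let $K\in\mathcal{D}$ be a differential operator which is a right factor of some non-zero constant coefficient operator $p\in\mathcal{D}_0$, i.e. $p=L\circ K$ for some $L\in\mathcal{D}$. If $R'$ is a commutative ring such that $R(K)\subset R'\subset\mathcal{D}$, then $R(K)=R'$. In other words, $R(K)$ is a maximal commutative subring of $\mathcal{D}$.
   Context: Let $n\ge 1$. $\mathcal{D}=\mathbb{C}(x_1,\ldots,x_n)[\partial_1,\ldots,\partial_n]$ denotes the (non-commutative) ring of differential operators in $n$ variables with rational function coefficients, where $\partial_i=\partial/\partial x_i$ and the product $\circ$ is composition of operators. $\mathcal{D}_0=\mathbb{C}[\partial_1,\ldots,\partial_n]\subset\mathcal{D}$ is the subring of constant coefficient differential operators. For a non-zero $K\in\mathcal{D}$ define $$R_0(K)=\{r\in\mathcal{D}_0 : K\circ r\in\mathcal{D}\circ K\}\subset\mathcal{D}_0,$$ the subring of those $r$ such that $K\circ r$ has $K$ as a right factor, and $$R(K)=(K\circ\mathcal{D}_0\circ K^{-1})\cap\mathcal{D}=K\circ R_0(K)\circ K^{-1}\subset\mathcal{D},$$ where $K^{-1}$ is the inverse of $K$ in a ring of microdifferential operators containing $\mathcal{D}$. Equivalently, $R(K)$ is the set of all $Q\in\mathcal{D}$ such that $Q\circ K=K\circ r$ for some $r\in\mathcal{D}_0$. $R(K)$ is a commutative subring of $\mathcal{D}$. *)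

(* Defs.v *)
From HB Require Import structures.
From mathcomp Require Import all_boot all_order all_algebra.
From mathcomp Require Import ring.
From mathcomp Require Import fraction complex ssrcomplements mpoly.
From mathcomp Require Import boolp classical_sets functions reals.

Set Implicit Arguments.
Unset Strict Implicit.
Unset Printing Implicit Defensive.

Import GRing.Theory.
Local Open Scope ring_scope.
Local Open Scope classical_set_scope.
Local Open Scope quotient_scope.

Notation ratfun k n := {fraction {mpoly k[n]}}.
Local Notation "x %:F" := (FracField.tofrac x).

Section PartialDerivatives.
Variables (k : fieldType) (n : nat).
Local Notation F := (ratfun k n).
Implicit Types (i j : 'I_n) (f g : F) (p q : {mpoly k[n]}) (m : 'X_{1..n}).

Lemma ratfun_repr f : f = (\n_(repr f))%:F / (\d_(repr f))%:F.
Proof.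
rewrite -[LHS]reprK; move: (repr f) => x; have x0 := denom_ratioP x.
unlock FracField.tofrac.
rewrite -[X in _ * X]FracField.pi_inv -[RHS]FracField.pi_mul.
rewrite /FracField.invf /FracField.mulf.
by rewrite !numden_Ratio ?oner_neq0 // mulr1 mul1r Ratio_numden.
Qed.

Lemma ratfunP f :
  exists2 pq : {mpoly k[n]} * {mpoly k[n]}, pq.2 != 0 & f = pq.1%:F / pq.2%:F.
Proof.
by exists (\n_(repr f), \d_(repr f)); [exact: denom_ratioP|exact: ratfun_repr].
Qed.

(* Quotient rule on a representative fraction of f; by pderivE below, the     *)
(* result does not depend on the fraction.                                    *)
Definition pderiv i f : F :=
  let p := \n_(repr f) in let q := \d_(repr f) in
  (p^`M(i) * q - p * q^`M(i))%:F / (q ^+ 2)%:F.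

Lemma pderivE i p q : q != 0 ->
  pderiv i (p%:F / q%:F) = (p^`M(i) * q - p * q^`M(i))%:F / (q ^+ 2)%:F.
Proof.
move=> q0; rewrite /pderiv.
have := ratfun_repr (p%:F / q%:F).
have := denom_ratioP (repr (p%:F / q%:F)).
move: (\n_ _) (\d_ _) => p' q' /= q'0 /eqP.
rewrite eqr_div ?tofrac_eq0 // -!tofracM tofrac_eq => /eqP e.
apply/eqP; rewrite eqr_div ?tofrac_eq0 ?expf_neq0 // -!tofracM tofrac_eq.
have : (p * q')^`M(i) = (p' * q)^`M(i) by rewrite e.
rewrite !mderivM => e'; rewrite -subr_eq0.
have -> : (p'^`M(i) * q' - p' * q'^`M(i)) * q ^+ 2 -
    (p^`M(i) * q - p * q^`M(i)) * q' ^+ 2 =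
  (p'^`M(i) * q + p' * q^`M(i) - (p^`M(i) * q' + p * q'^`M(i))) * (q * q')
  + (p * q' - p' * q) * (q * q'^`M(i) + q' * q^`M(i)) by ring.
by rewrite e' e !subrr !mul0r addr0.
Qed.

Lemma pderiv_poly i p : pderiv i p%:F = (p^`M(i))%:F.
Proof.
have -> : p%:F = p%:F / 1%:F by rewrite tofrac1 divr1.
rewrite pderivE ?oner_neq0 // expr1n tofrac1 divr1 mulr1.
by rewrite -[X in p * X^`M(i)]mpolyC1 mderivC mulr0 subr0.
Qed.

Lemma pderivD i : {morph pderiv i : f g / f + g}.
Proof.
move=> f g; have [[p q] /= q0 ->] := ratfunP f.
have [[r s] /= s0 ->] := ratfunP g.
rewrite addf_div ?tofrac_eq0 // -!tofracM -tofracD !pderivE ?mulf_neq0 //.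
rewrite addf_div ?tofrac_eq0 ?expf_neq0 // -!tofracM -tofracD.
apply/eqP; rewrite eqr_div ?tofrac_eq0 ?expf_neq0 ?mulf_neq0 ?expf_neq0 //.
by rewrite -!tofracM tofrac_eq mderivD !mderivM; apply/eqP; ring.
Qed.

Lemma pderivM i f g : pderiv i (f * g) = pderiv i f * g + f * pderiv i g.
Proof.
have [[p q] /= q0 ->] := ratfunP f; have [[r s] /= s0 ->] := ratfunP g.
rewrite mulf_div -!tofracM !pderivE ?mulf_neq0 // !mulf_div -!tofracM.
rewrite addf_div ?tofrac_eq0 ?mulf_neq0 ?expf_neq0 // -!tofracM -tofracD.
apply/eqP; rewrite eqr_div ?tofrac_eq0 ?mulf_neq0 ?expf_neq0 //.
by rewrite -!tofracM tofrac_eq !mderivM; apply/eqP; ring.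
Qed.

Lemma pderiv_comm i j f : pderiv i (pderiv j f) = pderiv j (pderiv i f).
Proof.
have [[p q] /= q0 ->] := ratfunP f; rewrite !pderivE ?expf_neq0 //.
congr (_%:F / _); rewrite !expr2 !(mderivM, mderivB, mderivN).
by rewrite (mderiv_comm i j p) (mderiv_comm i j q); ring.
Qed.

Lemma pderivB i : {morph pderiv i : f g / f - g}.
Proof.
move=> f g; apply: (addIr (pderiv i g)).
by rewrite -pderivD !subrK.
Qed.

(* The iterated partial derivative attached to the multi-index m. *)
Definition pderivm m : F -> F := \big[comp/idfun]_(i < n) iter (m i) (pderiv i).

Lemma pderivm0 f : pderivm 0%MM f = f.
Proof.
rewrite /pderivm; elim: (index_enum _) => [|i r IHr]; first by rewrite big_nil.
by rewrite big_cons mnm0E /= IHr.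
Qed.

Lemma pderivmS i m f : pderivm (U_(i) + m)%MM f = pderiv i (pderivm m f).
Proof.
rewrite /pderivm; set D := fun (m' : 'X_{1..n}) r =>
  \big[comp/idfun]_(j <- r) iter (m' j) (pderiv j).
suff /(_ _ (index_enum_uniq _)) : forall r, uniq r ->
    D (U_(i) + m)%MM r f = if i \in r then pderiv i (D m r f) else D m r f.
  by rewrite mem_index_enum.
elim=> [|j r IHr] /=; first by rewrite /D !big_nil.
case/andP=> jr ur; rewrite /D !big_cons /= -!/(D _ _) IHr // mnmDE mnm1E inE.
have [->|ij] /= := eqVneq i j.
  by rewrite (negbTE jr).
rewrite add0n; case: (i \in r) => //.
elim: (m j) => //= a ->; exact: pderiv_comm.
Qed.

Lemma pderivmB m : {morph pderivm m : f g / f - g}.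
Proof.
move=> f g; rewrite /pderivm.
elim: (index_enum _) => [|i r IHr]; first by rewrite !big_nil.
rewrite !big_cons /= IHr; elim: (m i) => //= a ->; exact: pderivB.
Qed.

(* The operator \sum_m P_m d^m with full symbol P = \sum_m P_m X^m. *)
Definition opsymb (P : {mpoly F[n]}) : F -> F :=
  fun f => \sum_(m <- msupp P) P@_m * pderivm m f.

Lemma opsymbE d (P : {mpoly F[n]}) f : (msize P <= d)%N ->
  opsymb P f = \sum_(m : 'X_{1..n < d}) P@_m * pderivm m f.
Proof.
move=> le_Pd; set I : subFinType _ := 'X_{1..n < d}.
rewrite /opsymb (big_mksub I) ?msupp_uniq //=; first last.
  by move=> x /msize_mdeg_lt /leq_trans; apply.
by rewrite big_rmcond //= => j /memN_msupp_eq0 ->; rewrite mul0r.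
Qed.

Lemma opsymbB (P Q : {mpoly F[n]}) f :
  opsymb (P - Q) f = opsymb P f - opsymb Q f.
Proof.
pose d := maxn (msize (P - Q)) (maxn (msize P) (msize Q)).
rewrite !(@opsymbE d) ?leq_max ?leqnn ?orbT // -sumrB.
by apply: eq_bigr => m _; rewrite mcoeffB mulrBl.
Qed.

Lemma opsymbM c m f : opsymb (c *: 'X_[m]) f = c * pderivm m f.
Proof.
pose d := maxn (msize (c *: 'X_[m] : {mpoly F[n]})) (mdeg m).+1.
rewrite (@opsymbE d) ?leq_maxl //.
have ltm : (mdeg m < d)%N by rewrite leq_max ltnSn orbT.
rewrite (bigD1 (BMultinom ltm)) //= big1 ?addr0.
  by rewrite mcoeffZ mcoeffX eqxx mulr1.
move=> m' ne; rewrite mcoeffZ mcoeffX.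
case: eqP => [e|_]; last by rewrite mulr0 mul0r.
by case/negP: ne; apply/eqP/val_inj.
Qed.

Lemma opsymb_arg_sub (P : {mpoly F[n]}) : {morph opsymb P : f g / f - g}.
Proof.
move=> f g; rewrite /opsymb -sumrB; apply: eq_bigr => m _.
by rewrite pderivmB mulrBr.
Qed.

Lemma pderivm_poly m p : pderivm m p%:F = (p^`M[m])%:F.
Proof.
suff : forall d m, mdeg m = d -> pderivm m p%:F = (p^`M[m])%:F by exact.
elim=> [m' /eqP|d IHd {}m dm].
  by rewrite mdeg_eq0 => /eqP ->; rewrite pderivm0 mderivm0m.
have /existsP[i mi] : [exists i, m i != 0%N].
  apply: contraPT (dm); rewrite negb_exists => /forallP m0.
  rewrite mdegE big1 // => i _; by apply/eqP; rewrite -[_ == _]negbK m0.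
have mE : m = (U_(i) + (m - U_(i)))%MM.
  by rewrite addmC submK // lep1mP.
have dm' : mdeg (m - U_(i))%MM = d.
  by apply/eqP; rewrite -eqSS -dm {2}mE mdegD mdeg1 add1n.
by rewrite mE pderivmS IHd // pderiv_poly [in RHS]addmC mderivmDm mderivmU1m.
Qed.

Lemma opsymb_inj : [pchar k] =i pred0 -> injective opsymb.
Proof.
move=> k0 P Q PQ; apply/eqP; rewrite -subr_eq0; apply/negPn/negP.
have : forall f, opsymb (P - Q) f = 0 by move=> f; rewrite opsymbB PQ subrr.
move: (P - Q) => {PQ} {}P P0; rewrite -msupp_eq0.
case E : (msupp P) => [//|m0 s] _.
have m0P : m0 \in msupp P by rewrite E mem_head.
have [m mP mmin] : exists2 m, m \in msupp P &
    forall m', m' \in msupp P -> (mdeg m <= mdeg m')%N.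
  have ex : exists d, has (fun m => mdeg m == d) (msupp P).
    by exists (mdeg m0); apply/hasP; exists m0.
  have [d /hasP[m mP /eqP md] dmin] := ex_minnP ex.
  by exists m => // m' m'P; rewrite md dmin //; apply/hasP; exists m'.
have := P0 'X_[m]%:F; rewrite /opsymb (bigD1_seq m) ?msupp_uniq //=.
rewrite big_seq_cond big1 ?addr0 => [|m' /andP[m'P m'm]]; last first.
  rewrite pderivm_poly mderivmX.
  have /existsP[i mi] : [exists i, (m i < m' i)%N].
    apply: contraNT m'm; rewrite negb_exists => /forallP le.
    have le' : (m' <= m)%MM by apply/mnm_lepP => i; rewrite leqNgt.
    have := mmin _ m'P; rewrite -[in X in (X <= _)%N](submK le') mdegD.
    rewrite -{2}[mdeg m']add0n leq_add2r leqn0 mdeg_eq0 => /eqP e.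
    by rewrite -(submK le') e add0m.
  by rewrite (bigD1 i) //= ffact_small // mul0n scale0r tofrac0 mulr0.
have -> : pderivm m 'X_[m]%:F = (\prod_(i < n) m i ^_ m i)%:R%:MP%:F.
  rewrite pderivm_poly mderivmX; set z := (m - m)%MM.
  have -> : z = 0%MM by apply/mnmP => i; rewrite mnmBE subnn mnm0E.
  by rewrite mpolyX0 alg_mpolyC.
apply/eqP; rewrite mulf_neq0 ?mcoeff_eq0 ?mP // tofrac_eq0 mpolyC_eq0.
rewrite ((pcharf0P _).1 k0) -lt0n prodn_gt0 // => i.
by rewrite ffactnn fact_gt0.
Qed.

Definition is_diffop (u : F -> F) := exists P, u = opsymb P.

Lemma is_diffopB u v : is_diffop u -> is_diffop v -> is_diffop (u - v).
Proof.
by move=> [P ->] [Q ->]; exists (P - Q); apply/funext => f; rewrite opsymbB.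
Qed.

Lemma is_diffop0 : is_diffop 0.
Proof. by exists 0; apply/funext => f; rewrite /opsymb msupp0 big_nil. Qed.

Lemma is_diffopD u v : is_diffop u -> is_diffop v -> is_diffop (u + v).
Proof.
move=> du dv; rewrite -[v]opprK -[- v]add0r.
by apply: is_diffopB => //; apply: is_diffopB => //; exact: is_diffop0.
Qed.

Lemma is_diffop_sum (I : Type) (r : seq I) (u : I -> F -> F) :
  (forall a, is_diffop (u a)) -> is_diffop (fun f => \sum_(a <- r) u a f).
Proof.
move=> du; rewrite -fct_sumE; elim/big_ind: _ => // [|*].
- exact: is_diffop0.
- exact: is_diffopD.
Qed.

Lemma is_diffop_id : is_diffop idfun.
Proof.
by exists (1 *: 'X_[0%MM]); apply/funext => f; rewrite opsymbM pderivm0 mul1r.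
Qed.

Lemma is_diffop_scale c u : is_diffop u -> is_diffop (fun f => c * u f).
Proof.
move=> [P ->]; rewrite /opsymb.
under eq_fun do rewrite mulr_sumr.
apply: is_diffop_sum => m; exists ((c * P@_m) *: 'X_[m]).
by apply/funext => f; rewrite opsymbM mulrA.
Qed.

Lemma is_diffop_pderiv i u : is_diffop u -> is_diffop (pderiv i \o u).
Proof.
move=> [P ->].
have -> : pderiv i \o opsymb P =
  (fun f => \sum_(m <- msupp P) (pderiv i P@_m * pderivm m f
                                 + P@_m * pderivm (U_(i) + m)%MM f)).
  apply/funext => f; rewrite /= /opsymb.
  elim: (msupp P) => [|m r IHr].
    by rewrite !big_nil -[0 in LHS](subrr 0) pderivB subrr.
  by rewrite !big_cons pderivD IHr pderivM pderivmS.
apply: is_diffop_sum => m.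
apply: (@is_diffopD (fun f => _) (fun f => _)).
- by eexists (_ *: 'X_[_]); apply/funext => f; rewrite opsymbM.
- by eexists (_ *: 'X_[_]); apply/funext => f; rewrite opsymbM.
Qed.

Lemma is_diffop_pderivm m u : is_diffop u -> is_diffop (pderivm m \o u).
Proof.
move=> du; rewrite /pderivm.
elim: (index_enum _) => [|i r IHr]; first by rewrite big_nil.
rewrite big_cons; elim: (m i) => //= a; exact: is_diffop_pderiv.
Qed.

Lemma is_diffop_comp u v : is_diffop u -> is_diffop v -> is_diffop (u \o v).
Proof.
move=> [P ->] dv.
apply: (@is_diffop_sum _ _ (fun m f => P@_m * pderivm m (v f))) => m.
exact/is_diffop_scale/is_diffop_pderivm.
Qed.

Definition diffop_pred : {pred F -> F} := [pred u | `[< is_diffop u >]].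

Fact diffop_zmod_closed : zmod_closed diffop_pred.
Proof.
split; first exact/asboolP/is_diffop0.
by move=> u v /asboolP du /asboolP dv; exact/asboolP/is_diffopB.
Qed.
HB.instance Definition _ :=
  GRing.isZmodClosed.Build (F -> F) diffop_pred diffop_zmod_closed.

(* k(x_1, ..., x_n)[d_1, ..., d_n], realised as operators on k(x_1, ..., x_n) *)
(* with composition as product. This action is faithful only when k has       *)
(* characteristic 0: by opsymb_inj, operators then correspond one-to-one to   *)
(* their full symbols.                                                        *)
Record diffop := Diffop {
  diffop_fun :> F -> F;
  diffop_funP : diffop_fun \in diffop_pred }.

HB.instance Definition _ := [isSub for diffop_fun].
HB.instance Definition _ := [Choice of diffop by <:].
HB.instance Definition _ := [SubChoice_isSubZmodule of diffop by <:].

Implicit Types u v w : diffop.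

Lemma diffopP u v : (forall f, u f = v f) -> u = v.
Proof. by move=> uv; apply/val_inj/funext. Qed.

Lemma diffop_is_diffop u : is_diffop u.
Proof. exact/asboolP/diffop_funP. Qed.

Definition diffop_one := Diffop (introT (asboolP _) is_diffop_id).
Definition diffop_mul u v := Diffop (introT (asboolP _)
  (is_diffop_comp (diffop_is_diffop u) (diffop_is_diffop v))).

Fact diffop_mulA : associative diffop_mul.
Proof. by move=> u v w; exact: diffopP. Qed.

Fact diffop_mul1l : left_id diffop_one diffop_mul.
Proof. by move=> u; exact: diffopP. Qed.

Fact diffop_mul1r : right_id diffop_one diffop_mul.
Proof. by move=> u; exact: diffopP. Qed.

Fact diffop_mulDl : left_distributive diffop_mul +%R.
Proof. by move=> u v w; exact: diffopP. Qed.

Lemma diffop_arg_sub u : {morph u : f g / f - g}.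
Proof. by have [P ->] := diffop_is_diffop u; exact: opsymb_arg_sub. Qed.

Fact diffop_mulDr : right_distributive diffop_mul +%R.
Proof.
move=> u v w; apply: diffopP => f /=.
apply: (addIr (- u (w f))).
by rewrite -[LHS]diffop_arg_sub /= !addrK.
Qed.

Fact diffop_one_neq0 : diffop_one != 0.
Proof.
apply/eqP => /(congr1 (fun u : diffop => u 1)) /= /eqP.
by rewrite oner_eq0.
Qed.

HB.instance Definition _ := GRing.Zmodule_isNzRing.Build diffop
  diffop_mulA diffop_mul1l diffop_mul1r diffop_mulDl diffop_mulDr
  diffop_one_neq0.

(* The operators \sum_m p_m d^m with p_m in k. *)
Definition const_coef : set diffop :=
  [set r | exists p : {mpoly k[n]},
    diffop_fun r = opsymb (map_mpoly (fun c : k => (c%:MP_[n])%:F) p)].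

(* (K D_0 K^-1) meet D, for nonzero K. The equation Q K = K r stands for      *)
(* Q = K r K^-1 and avoids inverting K in an overring.                        *)
Definition conj_const_coef (K : diffop) : set diffop :=
  [set Q | exists2 r, const_coef r & Q * K = K * r].
End PartialDerivatives.

Section Subrings.
Variable A : nzRingType.

Record comm_subring (S : set A) : Prop := CommSubring {
  comm_subring1 : S 1;
  comm_subringB : forall x y, S x -> S y -> S (x - y);
  comm_subringM : forall x y, S x -> S y -> S (x * y);
  comm_subringC : forall x y, S x -> S y -> x * y = y * x }.

Definition maximal_comm_subring (S : set A) : Prop :=
  comm_subring S /\ (forall S', comm_subring S' -> S `<=` S' -> S = S').
End Subrings.

(* Main.v *)
Require Import Defs.
From HB Require Import structures.
From mathcomp Require Import all_boot all_order all_algebra.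
From mathcomp Require Import fraction complex mpoly.
From mathcomp Require Import boolp classical_sets reals.

(** Write P for the polynomial whose constant coefficient operator is
    p = L K, and R(K) for [conj_const_coef K].

    Commutativity of R(K) is transported along Q K = K r from the commutative
    algebra of constant coefficient operators, by cancelling K on the right.

    For maximality it is enough that R(K) contains its own centralizer
    ([conj_const_coef_centralizer]).  Since r = s p satisfies
    K r = (K s L) K, every K s L with s of constant coefficients lies in R(K).
    If Q commutes with all of these, then L Q K commutes with every s, and an
    operator commuting with all partial derivatives has constant coefficients
    ([centralizer_const_coef]); so L Q K is given by a polynomial M, and
    Q K p = K M.  Formally, Q = K (M / P) K^-1, and what is left is to see that
    the rational function M / P is a polynomial.  Every power of Q commutes
    with R(K) as well, so L Q^j K is given by a polynomial for each j; that
    polynomial is P (M / P)^j.  Thus all powers of M / P have the common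
    denominator P, and polynomial rings are completely integrally closed
    ([mpoly_completely_integrally_closed]), so P divides M.

    Two tools are needed.  The ring of operators has no zero divisors
    ([diffop_mul_eq0]), because leading terms for a monomial order multiply:
    moving a derivation past a coefficient only creates terms of lower order.  And a rational function killed by all partial derivatives is a
    constant ([pderiv_eq0_const]). *)

Set Implicit Arguments.
Unset Strict Implicit.
Unset Printing Implicit Defensive.

Import Order.TTheory GRing.Theory Num.Theory.
Local Open Scope ring_scope.
Local Open Scope classical_set_scope.
Local Notation "x %:F" := (FracField.tofrac x).
Local Notation "c %:K" := ((c%:MP)%:F) (at level 2, format "c %:K").

(** * Exponents and complete integral closedness of polynomial rings *)

Section Monomials.
Variable n : nat.
Implicit Types (i : 'I_n) (m : 'X_{1..n}).

Lemma mnm_ind (P : 'X_{1..n} -> Prop) :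
  P 0%MM -> (forall i m, P m -> P (U_(i) + m)%MM) -> forall m, P m.
Proof.
move=> P0 PS m; have [d dm] := ubnP (mdeg m); elim: d m dm => // d IHd m.
rewrite ltnS; have [/existsP[i mi]|] := boolP [exists i, m i != 0%N].
  have -> : m = (U_(i) + (m - U_(i)))%MM by rewrite addmC submK // lep1mP.
  by rewrite mdegD mdeg1 add1n => /IHd; apply: PS.
rewrite negb_exists => /forallP m0 _; suff -> : m = 0%MM by [].
by apply/mnmP => i; rewrite mnm0E; apply/eqP/negPn.
Qed.

Lemma mnm_archimedean (p m c : 'X_{1..n}) :
  (forall j, (p *+ j <= c + m *+ j)%MM) -> (p <= m)%MM.
Proof.
move=> le_pm; apply/mnm_lepP => i.
(* The exponent c i + 1 is large enough to contradict m i < p i. *)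
have /mnm_lepP/(_ i) := le_pm (c i).+1; rewrite mnmDE !mulmnE => le.
rewrite leqNgt; apply/negP => mp.
have := leq_trans (leq_mul mp (leqnn (c i).+1)) le.
by rewrite mulSn leq_add2r ltnn.
Qed.

End Monomials.

Section MpolyDivision.
Variables (k : fieldType) (n : nat).
Implicit Types (p q M : {mpoly k[n]}).

Lemma mleadB_cancel p q :
  mlead p = mlead q -> mleadc p = mleadc q -> p != q ->
  (mlead (p - q) < mlead p)%O.
Proof.
move=> epq ecpq pq; rewrite lt_neqAle; apply/andP; split.
  apply: contra_neq pq => e; apply/eqP; rewrite -subr_eq0 -mleadc_eq0 e.
  by rewrite mcoeffB ecpq epq subrr.
by apply: le_trans (mleadB_le _ _) _; rewrite epq joinxx.
Qed.

(** The fraction M / p is a polynomial as soon as p (M / p)^j is one for all j.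
    Comparing leading exponents, j (mlead p) <= mlead p + j (mlead M) for all j
    forces mlead p <= mlead M, so one step of division by p is possible; it
    changes M / p by a polynomial, which preserves the hypothesis by the
    binomial formula, and lowers mlead M. *)
Lemma mpoly_completely_integrally_closed p M : p != 0 ->
  (forall j, exists s, p ^+ j * s = p * M ^+ j) -> exists r, M = r * p.
Proof.
move=> p0; elim/mleadrect: M => M IH pM.
have [->|M0] := eqVneq M 0; first by exists 0; rewrite mul0r.
have le_pM : (mlead p <= mlead M)%MM.
  apply: (@mnm_archimedean _ _ _ (mlead p)) => j.
  have [s e] := pM j; have s0 : s != 0.
    by apply: contraTneq isT => s0; move/eqP: e;
       rewrite s0 mulr0 eq_sym mulf_eq0 expf_eq0 (negbTE p0) (negbTE M0) andbF.
  move/(congr1 (@mlead _ _)): e; rewrite !mleadM ?expf_neq0 // !mleadX // => <-.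
  exact: lem_addr.
pose g := (mleadc M / mleadc p) *: 'X_[mlead M - mlead p].
have g0 : g * p != 0.
  rewrite mulf_neq0 // scaler_eq0 mulf_eq0 invr_eq0 !mleadc_eq0.
  by rewrite (negbTE p0) (negbTE M0) -msupp_eq0 msuppX.
have eg : mlead (g * p) = mlead M.
  rewrite mleadM //; last by apply: contra_neq g0 => ->; rewrite mul0r.
  rewrite mleadZ ?mleadXm ?submK //.
  by rewrite mulf_neq0 ?invr_eq0 ?mleadc_eq0.
have ec : mleadc (g * p) = mleadc M.
  rewrite eg /g -scalerAl mcoeffZ [_ * p]mulrC.
  have := mcoeffMX p (mlead M - mlead p)%MM (mlead p); rewrite submK // => ->.
  by rewrite divfK // mleadc_eq0.
have [->|ne] := eqVneq M (g * p); first by exists g.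
have [|j|r e] := IH (M - g * p).
- by apply: mleadB_cancel.
- pose s i := projT1 (cid (pM i)).
  have sE i : p ^+ i * s i = p * M ^+ i by rewrite /s; case: cid.
  exists (\sum_(i < j.+1) (s (j - i)%N * (- g) ^+ i) *+ 'C(j, i)).
  rewrite exprDn !mulr_sumr; apply: eq_bigr => i _.
  rewrite !mulrnAr -mulNr exprMn; congr (_ *+ _).
  have le_ij : (i <= j)%N by rewrite -ltnS.
  rewrite [in LHS](_ : p ^+ j = p ^+ (j - i) * p ^+ i); last first.
    by rewrite -exprD subnK.
  rewrite [RHS]mulrA -sE -!mulrA; congr (_ * _).
  by rewrite mulrCA; congr (_ * _); rewrite mulrC.
by exists (r + g); rewrite mulrDl -e subrK.
Qed.

End MpolyDivision.

(** * Rational functions with vanishing derivatives *)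

Section Constants.
Variables (k : fieldType) (n : nat).
Hypothesis k0 : [pchar k] =i pred0.
Implicit Types (p q : {mpoly k[n]}) (f : ratfun k n).

Lemma mderiv_eq0_const p : (forall i, p^`M(i) = 0) -> p = (p@_0%MM)%:MP.
Proof.
move=> dp; apply/mpolyP; elim/mnm_ind => [|i m _].
  by rewrite mcoeffC eqxx mulr1.
have ne0 : (m i).+1%:R != 0 :> k by rewrite ((pcharf0P _).1 k0).
have /eqP := congr1 (mcoeff m) (dp i).
rewrite mcoeff_deriv mcoeff0 -mulr_natr mulf_eq0 (negbTE ne0) orbF addmC.
by move/eqP->; rewrite mcoeffC mnmD_eq0 mnm1_eq0 /= mulr0.
Qed.

Lemma msize_mderiv_lt i q : q^`M(i) != 0 -> (msize q^`M(i) < msize q)%N.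
Proof.
move=> dq0; rewrite -(mlead_deg dq0).
have : (mlead q^`M(i) + U_(i))%MM \in msupp q.
  rewrite mcoeff_msupp; move: dq0; rewrite -mleadc_eq0 mcoeff_deriv.
  by apply: contra_neq => ->; rewrite mul0rn.
by move/msize_mdeg_lt; rewrite mdegD mdeg1 addn1.
Qed.

(** Induction on the size of a denominator q of f = p / q: the condition
    p' q = p q' says that f = p' / q' as well, a fraction with a smaller
    denominator unless q' = 0 for every partial derivative, and then q and
    hence p are constants. *)
Lemma pderiv_eq0_const f : (forall i, pderiv i f = 0) -> exists c : k, f = c%:K.
Proof.
have [[p q] /= q0 ->] := ratfunP f.
have [N] := ubnP (msize q); elim: N p q q0 => // N IH p q q0 leN df.
have dpq i : p^`M(i) * q = p * q^`M(i).
  have /eqP := df i; rewrite pderivE // mulf_eq0 invr_eq0 !tofrac_eq0.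
  by rewrite expf_eq0 (negbTE q0) andbF orbF subr_eq0 => /eqP.
have [/existsP[i dq0]|] := boolP [exists i, q^`M(i) != 0].
  have e : p%:F / q%:F = (p^`M(i))%:F / (q^`M(i))%:F.
    apply/eqP; rewrite eqr_div ?tofrac_eq0 // -!tofracM tofrac_eq.
    by rewrite dpq.
  rewrite e; apply: IH => //; last by rewrite -e.
  by rewrite -ltnS; apply: leq_trans leN; rewrite ltnS msize_mderiv_lt.
rewrite negb_exists => /forallP dq; have {}dq i : q^`M(i) = 0.
  by apply/eqP/negPn.
have dp i : p^`M(i) = 0.
  by apply/eqP; have /eqP := dpq i; rewrite dq mulr0 mulf_eq0 (negbTE q0) orbF.
exists (p@_0%MM / q@_0%MM).
have eq := mderiv_eq0_const dq.
have c0 : q@_0%MM != 0 by rewrite -(mpolyC_eq0 n) -eq.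
rewrite {1}(mderiv_eq0_const dp) {1}eq; apply: (canLR (mulfK _)).
  by rewrite tofrac_eq0 mpolyC_eq0.
by rewrite -tofracM -mpolyCM divfK.
Qed.

End Constants.

(** * Leading terms of differential operators *)

Section LeadingTerms.
Variables (k : fieldType) (n : nat).
Hypothesis k0 : [pchar k] =i pred0.
Local Notation F := (ratfun k n).
Implicit Types (i : 'I_n) (m : 'X_{1..n}) (P : {mpoly F[n]}) (u v : F -> F).

HB.instance Definition _ i :=
  GRing.isZmodMorphism.Build F F (@pderiv k n i) (@pderivB k n i).

Lemma opsymb0 f : opsymb 0 f = 0 :> F.
Proof. by rewrite /opsymb msupp0 big_nil. Qed.

(** The exponent m is only an upper bound for the exponents of u, and c may
    vanish: this makes lead_term additive at fixed m, with no case analysis on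
    cancellation. *)
Definition lead_term u m c :=
  exists P, [/\ u =1 opsymb P, (mlead P <= m)%O & P@_m = c].

Lemma lead_term_eq u v m c : u =1 v -> lead_term u m c -> lead_term v m c.
Proof. by move=> uv [P [uP lP cP]]; exists P; split => // f; rewrite -uv. Qed.

Lemma lead_term0 m : lead_term (fun=> 0) m 0.
Proof.
by exists 0; rewrite mlead0 le0x mcoeff0; split => // f; rewrite opsymb0.
Qed.

Lemma lead_term_lt u m m' c : (m < m')%O -> lead_term u m c -> lead_term u m' 0.
Proof.
move=> mm' [P [uP lP cP]]; exists P; split => //.
  exact: le_trans lP (ltW mm').
by rewrite mcoeff_gt_mlead // (le_lt_trans lP).
Qed.

Lemma lead_termD u v m a b : lead_term u m a -> lead_term v m b ->
  lead_term (fun f => u f + v f) m (a + b).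
Proof.
move=> [P [uP lP cP]] [Q [vQ lQ cQ]]; exists (P + Q); split.
- move=> f; rewrite uP vQ; apply: (addIr (- opsymb Q f)).
  by rewrite -opsymbB !addrK.
- by apply: le_trans (mleadD_le _ _) _; rewrite leUx lP.
- by rewrite mcoeffD cP cQ.
Qed.

Lemma lead_term_sum (I : eqType) (r : seq I) (u : I -> F -> F) m c :
  (forall a, a \in r -> lead_term (u a) m (c a)) ->
  lead_term (fun f => \sum_(a <- r) u a f) m (\sum_(a <- r) c a).
Proof.
elim: r => [|a r IHr] lu.
  by rewrite big_nil; apply: lead_term_eq (lead_term0 m) => f; rewrite big_nil.
rewrite big_cons.
apply: lead_term_eq (lead_termD (lu a (mem_head _ _)) (IHr _)) => [f|b br].
  by rewrite big_cons.
by apply: lu; rewrite inE br orbT.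
Qed.

Lemma lead_term_monomial m c : lead_term (fun f => c * pderivm m f) m c.
Proof.
exists (c *: 'X_[m]); split.
- by move=> f; rewrite opsymbM.
- by apply: le_trans (mleadZ_le _ _) _; rewrite mleadXm.
- by rewrite mcoeffZ mcoeffX eqxx mulr1.
Qed.

Lemma lead_termZ u m a c :
  lead_term u m a -> lead_term (fun f => c * u f) m (c * a).
Proof.
move=> [P [uP lP cP]]; exists (c *: P); split.
- move=> f; rewrite uP !(@opsymbE _ _ (msize P)) ?msizeZ_le // mulr_sumr.
  by apply: eq_bigr => m' _; rewrite mcoeffZ mulrA.
- exact: le_trans (mleadZ_le _ _) lP.
- by rewrite mcoeffZ cP.
Qed.

Lemma sum_msupp_mcoeff P m : \sum_(m' <- msupp P) P@_m' * (m' == m)%:R = P@_m.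
Proof.
by rewrite [in RHS](mpolyE P) raddf_sum /=; apply: eq_bigr => m' _;
   rewrite mcoeffZ mcoeffX.
Qed.

(** Differentiating c d^m gives c d^(m + U_i), which moves the exponent, plus
    (d_i c) d^m, which is of lower order. *)
Lemma lead_term_pderiv u i m c :
  lead_term u m c -> lead_term (pderiv i \o u) (U_(i) + m)%MM c.
Proof.
move=> [P [uP lP <-]]; rewrite -(sum_msupp_mcoeff P m).
apply: (@lead_term_eq (fun f => \sum_(m' <- msupp P)
  (pderiv i P@_m' * pderivm m' f + P@_m' * pderivm (U_(i) + m')%MM f))).
  move=> f; rewrite /= uP /opsymb raddf_sum; apply: eq_bigr => m' _.
  by rewrite pderivmS -pderivM.
apply: lead_term_sum => m' /msupp_le_mlead m'P; rewrite -[_ * _]add0r.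
have le_m : (m' <= m)%O by apply: le_trans lP.
apply: lead_termD.
  apply: lead_term_lt (lead_term_monomial m' _).
  apply: le_lt_trans le_m _; rewrite -[X in (X < _)%O]add0m ltmc_add2l.
  by rewrite lt0x mnm1_eq0.
have [->|ne] := eqVneq m' m.
  by rewrite mulr1; apply: lead_term_monomial.
rewrite mulr0; apply: lead_term_lt (lead_term_monomial _ _).
by rewrite ltmc_add2r lt_neqAle ne.
Qed.

Lemma lead_term_pderivm u m' m c :
  lead_term u m c -> lead_term (pderivm m' \o u) (m' + m)%MM c.
Proof.
move=> lu; elim/mnm_ind: m' => [|i m' IH].
  by rewrite add0m; apply: lead_term_eq lu => f; rewrite /= pderivm0.
rewrite -addmA; apply: lead_term_eq (lead_term_pderiv i IH) => f /=.
by rewrite pderivmS.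
Qed.

(** A term of u of exponent l < m contributes only below m + m'. *)
Lemma lead_term_comp u v m m' a b :
  lead_term u m a -> lead_term v m' b -> lead_term (u \o v) (m + m')%MM (a * b).
Proof.
move=> [P [uP lP <-]] lv; rewrite -(sum_msupp_mcoeff P m) mulr_suml.
apply: (@lead_term_eq (fun f => \sum_(l <- msupp P) P@_l * pderivm l (v f))).
  by move=> f; rewrite /= uP.
apply: lead_term_sum => l /msupp_le_mlead lP'.
have le_lm : (l <= m)%O by apply: le_trans lP.
have [->|ne] := eqVneq l m.
  by rewrite mulr1; apply/lead_termZ/lead_term_pderivm.
rewrite mulr0 mul0r.
apply: lead_term_lt (lead_termZ _ (lead_term_pderivm l lv)).
by rewrite ltmc_add2l lt_neqAle ne.
Qed.

Lemma lead_term_nonzero (u : diffop k n) : u != 0 ->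
  exists m, exists2 c, c != 0 & lead_term u m c.
Proof.
have [P uP] := diffop_is_diffop u; move=> u0.
exists (mlead P), (mleadc P); last by exists P; split => // f; rewrite uP.
rewrite mleadc_eq0; apply: contra_neq u0 => P0; apply: diffopP => f.
by rewrite uP P0 opsymb0.
Qed.

Lemma diffop_mulE (u v : diffop k n) f : (u * v) f = u (v f).
Proof. by []. Qed.

Lemma diffop_mul_eq0 (u v : diffop k n) : u * v = 0 -> u = 0 \/ v = 0.
Proof.
move=> uv0.
have [->|/lead_term_nonzero[m [a a0 lu]]] := eqVneq u 0; first by left.
have [->|/lead_term_nonzero[m' [b b0 lv]]] := eqVneq v 0; first by right.
have [P [uvP _ cP]] := lead_term_comp lu lv.
have : opsymb P = opsymb 0.
  apply/funext => f; rewrite -uvP opsymb0.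
  exact: (congr1 (fun w : diffop k n => w f) uv0).
move/(opsymb_inj k0) => P0; move: cP; rewrite P0 mcoeff0 => /esym/eqP.
by rewrite mulf_eq0 (negbTE a0) (negbTE b0).
Qed.

Lemma diffop_mulfI (u v w : diffop k n) : u != 0 -> u * v = u * w -> v = w.
Proof.
move=> u0 /eqP; rewrite -subr_eq0 -mulrBr => /eqP/diffop_mul_eq0[ue|/eqP].
  by rewrite ue eqxx in u0.
by rewrite subr_eq0 => /eqP.
Qed.

Lemma diffop_mulIf (u v w : diffop k n) : u != 0 -> v * u = w * u -> v = w.
Proof.
move=> u0 /eqP; rewrite -subr_eq0 -mulrBl => /eqP/diffop_mul_eq0[/eqP|ue].
  by rewrite subr_eq0 => /eqP.
by rewrite ue eqxx in u0.
Qed.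

End LeadingTerms.

(** * Operators with constant coefficients *)

Definition const_embed (k : fieldType) n : k -> ratfun k n := fun c => c%:K.

(** Locked, because comparing two such operators by unfolding them down to their
    action on rational functions is intractable. *)
HB.lock Definition const_op (k : fieldType) n (p : {mpoly k[n]}) : diffop k n :=
  Diffop (introT (asboolP _)
    (ex_intro _ (map_mpoly (@const_embed k n) p) erefl)).

Section ConstantCoefficients.
Variables (k : fieldType) (n : nat).
Hypothesis k0 : [pchar k] =i pred0.
Local Notation F := (ratfun k n).
Implicit Types (i : 'I_n) (m : 'X_{1..n}) (p q : {mpoly k[n]}) (u : diffop k n).

Lemma pderiv_const i (c : k) (f : F) : pderiv i (c%:K * f) = c%:K * pderiv i f.
Proof. by rewrite pderivM pderiv_poly mderivC tofrac0 mul0r add0r. Qed.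

Lemma pderivm_const m (c : k) (f : F) :
  pderivm m (c%:K * f) = c%:K * pderivm m f.
Proof.
elim/mnm_ind: m => [|i m IH]; first by rewrite !pderivm0.
by rewrite !pderivmS IH pderiv_const.
Qed.

Lemma pderivmU i (f : F) : pderivm U_(i)%MM f = pderiv i f.
Proof. by rewrite -(addm0 U_(i)%MM) pderivmS pderivm0. Qed.

Lemma pderivmD m m' (f : F) : pderivm (m + m')%MM f = pderivm m (pderivm m' f).
Proof.
elim/mnm_ind: m => [|i m IH]; first by rewrite add0m pderivm0.
by rewrite -addmA !pderivmS IH.
Qed.

Local Notation const_embed := (@const_embed k n).

Fact const_embed_monoid : monoid_morphism const_embed.
Proof.
rewrite /const_embed; split; first by rewrite mpolyC1 tofrac1.
by move=> a b; rewrite mpolyCM tofracM.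
Qed.
Fact const_embed_zmod : zmod_morphism const_embed.
Proof. by move=> a b; rewrite /const_embed mpolyCB tofracB. Qed.
HB.instance Definition _ :=
  GRing.isZmodMorphism.Build k F const_embed const_embed_zmod.
HB.instance Definition _ :=
  GRing.isMonoidMorphism.Build k F const_embed const_embed_monoid.

Lemma const_embed_inj : injective const_embed.
Proof. exact: fmorph_inj. Qed.

Local Notation const_op := (@const_op k n).

Lemma const_opE p : diffop_fun (const_op p) = opsymb (map_mpoly const_embed p).
Proof. by rewrite unlock. Qed.

Lemma const_coefP u : const_coef u <-> exists p, u = const_op p.
Proof.
split=> [[p up]|[p ->]]; exists p; last by rewrite const_opE.
by apply: diffopP => f; rewrite up const_opE.
Qed.

Fact const_op_zmod : zmod_morphism const_op.
Proof.
by move=> p q; apply: diffopP => f; rewrite /= !const_opE raddfB opsymbB.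
Qed.
HB.instance Definition _ :=
  GRing.isZmodMorphism.Build {mpoly k[n]} (diffop k n) const_op const_op_zmod.

Lemma const_opZX c m f : const_op (c *: 'X_[m]) f = c%:K * pderivm m f.
Proof. by rewrite const_opE map_mpolyZ map_mpolyX opsymbM. Qed.

Fact const_op_monoid : monoid_morphism const_op.
Proof.
split.
  apply: diffopP => f; rewrite -mpolyX0 -[X in const_op X]scale1r const_opZX.
  by rewrite pderivm0 mpolyC1 tofrac1 mul1r.
have monoM a m b m' : const_op (a *: 'X_[m] * (b *: 'X_[m'])) =
    const_op (a *: 'X_[m]) * const_op (b *: 'X_[m']).
  rewrite -scalerAl -scalerAr scalerA -mpolyXD; apply: diffopP => f.
  rewrite [LHS]const_opZX [RHS]diffop_mulE 2!const_opZX pderivm_const pderivmD.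
  by rewrite mpolyCM tofracM mulrA.
move=> p q; rewrite (mpolyE p) (mpolyE q).
rewrite mulr_suml !raddf_sum mulr_suml; apply: eq_bigr => m _.
rewrite mulr_sumr raddf_sum mulr_sumr; apply: eq_bigr => m' _.
exact: monoM.
Qed.
HB.instance Definition _ :=
  GRing.isMonoidMorphism.Build {mpoly k[n]} (diffop k n) const_op
    const_op_monoid.

Lemma const_op0 : const_op 0 = 0.
Proof. exact: raddf0. Qed.

Lemma const_op1 : const_op 1 = 1.
Proof. exact: rmorph1. Qed.

Lemma const_opB p q : const_op (p - q) = const_op p - const_op q.
Proof. exact: raddfB. Qed.

Lemma const_opM p q : const_op (p * q) = const_op p * const_op q.
Proof. exact: rmorphM. Qed.

Lemma const_opC p q : const_op p * const_op q = const_op q * const_op p.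
Proof. by rewrite -!const_opM mulrC. Qed.

Lemma const_op_inj : injective const_op.
Proof.
move=> p q /(congr1 (@diffop_fun k n)).
rewrite !const_opE => /(opsymb_inj k0) pq.
apply/mpolyP => m; apply: const_embed_inj.
by rewrite -[LHS]mcoeff_map_mpoly -[RHS]mcoeff_map_mpoly pq.
Qed.

Lemma opsymb_pderiv_commutator i (P : {mpoly F[n]}) f :
  pderiv i (opsymb P f) - opsymb P (pderiv i f) =
  opsymb (map_mpoly (@pderiv k n i) P) f.
Proof.
set Q := map_mpoly _ P; pose d := maxn (msize P) (msize Q).
rewrite !(@opsymbE _ _ d) ?leq_max ?leqnn ?orbT // raddf_sum -sumrB.
apply: eq_bigr => m _; rewrite mcoeff_map_mpoly /= pderivM -pderivmS.
by rewrite addmC pderivmD pderivmU addrK.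
Qed.

(** By [opsymb_pderiv_commutator] and uniqueness of symbols, commuting with d_i
    means that d_i kills every coefficient of the symbol. *)
Lemma centralizer_const_coef u :
  (forall p, u * const_op p = const_op p * u) -> const_coef u.
Proof.
have [P uP] := diffop_is_diffop u; move=> cu.
have dP i : map_mpoly (@pderiv k n i) P = 0.
  apply: (opsymb_inj k0); apply/funext => f; rewrite opsymb0.
  rewrite -opsymb_pderiv_commutator -uP.
  have XE g : const_op 'X_i g = pderiv i g.
    rewrite -[X in const_op X]scale1r const_opZX mpolyC1 tofrac1 mul1r.
    by rewrite pderivmU.
  rewrite -!XE; apply/eqP; rewrite subr_eq0; apply/eqP.
  exact/esym/(congr1 (fun w : diffop k n => w f) (cu 'X_i)).
have cP m : exists c : k, P@_m = c%:K.
  apply: (pderiv_eq0_const k0) => i.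
  by rewrite -mcoeff_map_mpoly dP mcoeff0.
pose c m := projT1 (cid (cP m)).
have cE m : P@_m = (c m)%:K by rewrite /c; case: cid.
apply/const_coefP; exists (\sum_(m <- msupp P) c m *: 'X_[m]).
apply: diffopP => f; rewrite uP const_opE; congr (opsymb _ f).
rewrite raddf_sum {1}(mpolyE P); apply: eq_bigr => m _.
by rewrite /= map_mpolyZ map_mpolyX cE.
Qed.

End ConstantCoefficients.

(** * The centralizer of the conjugated constant coefficient operators *)

Section MaximalCommutative.
Variables (k : fieldType) (n : nat).
Hypothesis k0 : [pchar k] =i pred0.
Local Notation D := (diffop k n).
Local Notation cc := (@const_op k n).
Implicit Types (K L Q : D) (P : {mpoly k[n]}).

Lemma conj_const_coefP K Q :
  conj_const_coef K Q <-> exists r, Q * K = K * cc r.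
Proof.
split=> [[_ /const_coefP[r ->] e]|[r e]]; first by exists r.
by exists (cc r) => //; apply/const_coefP; exists r.
Qed.

Lemma conj_const_coef_prod K x y r s : x * K = K * cc r -> y * K = K * cc s ->
  x * y * K = K * (cc r * cc s).
Proof. by move=> xr ys; rewrite -mulrA ys mulrA xr mulrA. Qed.

Lemma conj_const_coef_comm_subring K : K != 0 ->
  comm_subring (conj_const_coef K).
Proof.
move=> K0; split=> [|x y|x y|x y]; rewrite ?conj_const_coefP.
- by exists 1; rewrite const_op1 mul1r mulr1.
- move=> [r xr] [s ys]; exists (r - s).
  by rewrite mulrBl xr ys const_opB mulrBr.
- move=> [r xr] [s ys]; exists (r * s).
  by rewrite const_opM; exact: conj_const_coef_prod.
- move=> [r xr] [s ys]; apply: (diffop_mulIf k0 K0).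
  rewrite (conj_const_coef_prod xr ys) (conj_const_coef_prod ys xr).
  by rewrite const_opC.
Qed.

Lemma conj_const_coef_sandwich K L P s :
  cc P = L * K -> conj_const_coef K (K * cc s * L).
Proof.
move=> PLK; apply/conj_const_coefP; exists (s * P).
by rewrite const_opM PLK !mulrA.
Qed.

(** Commuting Q with K s L and multiplying by K on the right gives
    Q K s p = K s (L Q K), where p = L K; the case s = 1 is Q K p = K (L Q K).
    As s and p commute, K (L Q K) s = K s (L Q K), and K cancels: L Q K commutes
    with every s of constant coefficients. *)
Lemma factor_conj_const_coef K L P Q : P != 0 -> cc P = L * K ->
  (forall Q', conj_const_coef K Q' -> Q * Q' = Q' * Q) ->
  exists m, L * Q * K = cc m.
Proof.
move=> P0 PLK cQ; suff /const_coefP[m ->] : const_coef (L * Q * K) by exists m.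
have K0 : K != 0.
  apply: contra_neq P0 => K0; apply: (const_op_inj k0).
  by rewrite PLK K0 mulr0 const_op0.
have QK s : Q * K * cc (s * P) = K * cc s * (L * Q * K).
  have /(congr1 (fun w => w * K)) := cQ _ (conj_const_coef_sandwich s PLK).
  by rewrite const_opM PLK !mulrA.
apply: (centralizer_const_coef k0) => s; apply: (diffop_mulfI k0 K0).
rewrite [RHS]mulrA -QK const_opM const_opC !mulrA.
by have := QK 1; rewrite mul1r const_op1 mulr1 !mulrA => ->.
Qed.

(** With Q = K (m / P) K^-1, the operator L Q^j K is P (m / P)^j; as it is a
    polynomial for every j, complete integral closedness applies to m / P. *)
Lemma conj_const_coef_centralizer K L P Q : P != 0 -> cc P = L * K ->
  (forall Q', conj_const_coef K Q' -> Q * Q' = Q' * Q) ->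
  conj_const_coef K Q.
Proof.
move=> P0 PLK cQ.
have cQX j : exists m, L * Q ^+ j * K = cc m.
  apply: (factor_conj_const_coef P0 PLK) => Q' /cQ cQ'; apply/commr_sym.
  exact/commrX/commr_sym.
have [m mE] := cQX 1%N; rewrite expr1 in mE.
have QK : Q * K * cc P = K * cc m.
  have : conj_const_coef K (K * L).
    by have := conj_const_coef_sandwich 1 PLK; rewrite const_op1 mulr1.
  move=> /cQ /(congr1 (fun w => w * K)).
  by rewrite -mE PLK !mulrA.
have powE j m' : L * Q ^+ j * K = cc m' -> P ^+ j * m' = P * m ^+ j.
  elim: j m' => [|j IH] m' m'E.
    rewrite expr0 mulr1 -PLK in m'E; rewrite !expr0 mul1r mulr1.
    exact/esym/(const_op_inj k0).
  have [m1 m1E] := cQX j.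
  have : P * m' = m1 * m.
    apply: (const_op_inj k0); rewrite !const_opM const_opC -m'E -m1E.
    by rewrite exprSr -!mulrA -QK !mulrA.
  rewrite exprSr -mulrA => ->; rewrite mulrA (IH _ m1E) -mulrA.
  by rewrite -exprSr.
have [j|r rE] := @mpoly_completely_integrally_closed _ _ P m P0.
  by have [m' /powE] := cQX j; exists m'.
apply/conj_const_coefP; exists r.
have ccP0 : cc P != 0.
  by apply: contra_neq P0 => e; apply: (const_op_inj k0); rewrite e const_op0.
by apply: (diffop_mulIf k0 ccP0); rewrite QK rE const_opM mulrA.
Qed.

End MaximalCommutative.

Theorem theorem2p1 (R : realType) (n : nat) (n_gt0 : (0 < n)%N)
    (K L p : diffop R[i] n) (p_const : const_coef p) (p_neq0 : p != 0)
    (pLK : p = L * K) :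
  maximal_comm_subring (conj_const_coef K).
Proof.
have k0 := @pchar_num R[i].
have [P pP] := (const_coefP p).1 p_const.
have P0 : P != 0 by apply: contra_neq p_neq0 => P0; rewrite pP P0 const_op0.
have K0 : K != 0 by apply: contra_neq p_neq0 => K0; rewrite pLK K0 mulr0.
split=> [|S' [_ _ _ S'C] RS']; first exact: conj_const_coef_comm_subring.
apply/seteqP; split=> // Q S'Q.
apply: (conj_const_coef_centralizer k0 P0); first by rewrite -pP pLK.
by move=> Q' /RS' S'Q'; apply: S'C.
Qed.
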